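(* For every finite group $\mathfrak{G}$ and every $d \in \{8,12,16,20,24\}$ there exist infinitely many pairwise non-isomorphic finite $d$-regular nut graphs $G$ such that $\mathrm{Aut}(G) \cong \mathfrak{G}$.
   Context: All graphs are finite, simple and connected. For a graph $G$, $\mathbf{A}(G)$ denotes its adjacency matrix and the nullity $\eta(G)$ is the dimension of the kernel of $\mathbf{A}(G)$. A nut graph is a simple graph of order at least 2 with $\eta(G)=1$ such that a (equivalently every) non-zero vector $\mathbf{x}=[x_1,\dots,x_n]^\intercal \in \ker \mathbf{A}(G)$ is full, i.e. $x_i \neq 0$ for all $i$. A graph is $d$-regular if every vertex has degree $d$. $\mathrm{Aut}(G)$ is the full automorphism group of $G$. *)

(* Defs.v *)
From HB Require Import structures.
From mathcomp Require Import all_boot all_order all_algebra all_fingroup.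
From mathcomp Require Import reals.

Set Implicit Arguments.
Unset Strict Implicit.
Unset Printing Implicit Defensive.

Import GRing.Theory.
Local Open Scope ring_scope.

Record sgraph := SGraph {
  vertex : finType;
  adj : rel vertex;
  adj_sym : symmetric adj;
  adj_irr : irreflexive adj
}.

Definition connected_graph (G : sgraph) : Prop :=
  forall x y : vertex G, connect (@adj G) x y.

Definition degree (G : sgraph) (x : vertex G) : nat := #|[set y | adj x y]|.

Definition regular_graph (d : nat) (G : sgraph) : Prop :=
  forall x : vertex G, degree x = d.

Definition graph_iso (G H : sgraph) : Prop :=
  exists f : vertex G -> vertex H,
    bijective f /\ forall x y, adj (f x) (f y) = adj x y.

Definition graph_aut (G : sgraph) : {set {perm vertex G}} :=
  [set s : {perm vertex G} | [forall x, forall y, adj (s x) (s y) == adj x y]].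

Lemma graph_autP (G : sgraph) (s : {perm vertex G}) :
  reflect (forall x y, adj (s x) (s y) = adj x y) (s \in graph_aut G).
Proof.
rewrite inE; apply: (iffP forallP) => [h x y | h x].
  by move/forallP: (h x) => /(_ y) /eqP.
by apply/forallP => y; rewrite h.
Qed.

Lemma graph_aut_group_set (G : sgraph) : group_set (graph_aut G).
Proof.
apply/group_setP; split => [|s t /graph_autP hs /graph_autP ht]; apply/graph_autP => x y.
  by rewrite !perm1.
by rewrite !permM ht hs.
Qed.

Canonical graph_aut_group (G : sgraph) : {group {perm vertex G}} :=
  Group (graph_aut_group_set G).

Section Spectral.
Variables (F : fieldType) (G : sgraph).

(* Rows and columns follow the library's enumeration of the vertices. *)
Definition adjmx : 'M[F]_#|vertex G| :=
  \matrix_(i, j) (adj (enum_val i) (enum_val j))%:R.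

Definition adj_ker : {vspace 'cV[F]_#|vertex G|} :=
  lker (linfun (mulmx adjmx : 'cV[F]_#|vertex G| -> 'cV[F]_#|vertex G|)).

Definition nullity : nat := \dim adj_ker.

Definition full_vector n (x : 'cV[F]_n) : Prop := forall i, x i 0 != 0.

Definition nut_graph : Prop :=
  [/\ (2 <= #|vertex G|)%N,
      nullity = 1%N
    & forall x, x \in adj_ker -> x != 0 -> full_vector x].

Lemma mem_adj_ker (x : 'cV[F]_#|vertex G|) :
  (x \in adj_ker) = (adjmx *m x == 0).
Proof. by rewrite memv_ker lfunE. Qed.

End Spectral.

(* Main.v *)
Require Import Defs.
From mathcomp Require Import all_boot all_order all_algebra all_fingroup.
From mathcomp Require Import reals.
From mathcomp Require Import zify ring lra.

(* Let [d = 4 t] with [t >= 2].  To every vertex (root) of a connected 4-regular graph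
   attach a gadget on [4 t + 3] vertices through its [4 t - 4] ports.  The adjacency
   matrix of the gadget is nonsingular, and with value 1 at the root the kernel
   equations inside the gadget force the values 1 and -1 at odd and even positions,
   which sum to -4 over the ports.  The kernel equation at a root then says that the
   values on the roots are harmonic, hence constant: the graph is a nut graph.

   Adjacent vertices of a gadget have at least [4 t - 4] common neighbours, a root and
   any of its neighbours have fewer, so automorphisms preserve roots and gadgets.  They
   fix the kernel vector, hence preserve parity inside the gadgets, which makes the
   gadgets rigid and two kinds of gadgets distinguishable.  Automorphisms are therefore
   the automorphisms of the root graph preserving a 2-colouring of the roots.

   The root graph is the voltage cover, with fibre the given group, of the circulant
   graph on Z/q with steps 1 (trivial voltage) and 2 (voltages running through the
   whole group).  The colouring marks 3, 4 and 6 in Z/q; it identifies the Z/q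
   coordinate of every root, and what remains are the left translations. *)

Set Implicit Arguments.
Unset Strict Implicit.
Unset Printing Implicit Defensive.

Import GRing.Theory Num.Theory.

(** * Neighbourhood sums, nut graphs and automorphisms *)

Definition nbr_sum (V : nmodType) (T : finType) (e : rel T) (f : T -> V) (x : T) : V :=
  (\sum_(y | e x y) f y)%R.

Lemma nbr_sum_const (V : nmodType) (T : finType) (e : rel T) (a : V) x :
  nbr_sum e (fun=> a) x = (a *+ #|[set y | e x y]|)%R.
Proof. by rewrite /nbr_sum sumr_const cardsE. Qed.

Section KernelFunctions.

Local Open Scope ring_scope.

Variables (F : fieldType) (G : sgraph).

Definition kernel_fun (f : vertex G -> F) : Prop := forall x, nbr_sum (@adj G) f x = 0.

Lemma mem_adj_kerP (v : 'cV[F]_#|vertex G|) :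
  reflect (kernel_fun (fun x => v (enum_rank x) 0)) (v \in adj_ker F G).
Proof.
have mulE x :
    nbr_sum (@adj G) (fun y => v (enum_rank y) 0) x = (adjmx F G *m v) (enum_rank x) 0.
  rewrite mxE [RHS](reindex (@enum_rank (vertex G))); last first.
    by apply: onW_bij; exists enum_val => i; rewrite ?enum_rankK ?enum_valK.
  rewrite /nbr_sum big_mkcond; apply: eq_bigr => y _ /=.
  by rewrite !mxE !enum_rankK; case: adj; rewrite ?mul1r ?mul0r.
rewrite mem_adj_ker; apply: (iffP eqP) => [Av0 x | ker_v]; first by rewrite mulE Av0 mxE.
by apply/matrixP => i j; rewrite !ord1 -[i]enum_valK -mulE mxE; apply: ker_v.
Qed.

Lemma nut_graph_of_kernel_fun (f : vertex G -> F) :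
    (2 <= #|vertex G|)%N -> kernel_fun f -> (forall x, f x != 0) ->
    (forall g, kernel_fun g -> exists a, forall x, g x = a * f x) ->
  nut_graph F G.
Proof.
move=> G2 ker_f f_neq0 ker_line.
pose vf : 'cV[F]_#|vertex G| := \col_i f (enum_val i).
have ker_scale v : v \in adj_ker F G -> exists a, v = a *: vf.
  move=> /mem_adj_kerP/ker_line[a vE]; exists a; apply/matrixP => i j.
  by rewrite !ord1 !mxE -vE enum_valK.
have vf_ker : vf \in adj_ker F G.
  apply/mem_adj_kerP => x; rewrite -[RHS](ker_f x).
  by apply: eq_bigr => y _; rewrite mxE enum_rankK.
have vf_neq0 : vf != 0.
  have /card_gt0P[x _] : (0 < #|vertex G|)%N by exact: leq_trans G2.
  apply/eqP => /matrixP/(_ (enum_rank x) 0)/eqP.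
  by rewrite !mxE enum_rankK (negbTE (f_neq0 x)).
split=> // [|v /ker_scale[a ->]].
  have -> : nullity F G = \dim <[vf]>%VS; last by rewrite dim_vline vf_neq0.
  congr (\dim _); apply/eqP; rewrite eqEsubv -memvE vf_ker andbT.
  by apply/subvP => v /ker_scale[a ->]; rewrite memvZ ?memv_line.
rewrite scaler_eq0 negb_or => /andP[a_neq0 _] i.
by rewrite !mxE mulf_neq0.
Qed.

End KernelFunctions.

Lemma harmonic_const (R : realDomainType) (G : sgraph) (f : vertex G -> R) :
    connected_graph G -> (forall x, nbr_sum (@adj G) f x = f x *+ degree x)%R ->
  forall x y, f x = f y.
Proof.
move=> conn harm x y.
have [z _ z_max] := @Order.TotalTheory.arg_maxP _ _ _ x xpredT f isT.
suff max_const w : f w = f z by rewrite !max_const.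
have /connectP[p] := conn z w; elim: p z z_max => [|z' p IHp] z z_max /=.
  by move=> _ ->.
case/andP => zz' pz' wE.
have fz' : f z' = f z.
  have : (\sum_(u | adj z u) (f z - f u) = 0)%R.
    by rewrite sumrB [X in (_ - X)%R]harm -[X in (X - _)%R]/(nbr_sum _ _ _)
               nbr_sum_const subrr.
  move=> /psumr_eq0P defect0; apply/eqP; rewrite eq_sym -subr_eq0; apply/eqP.
  by apply: defect0 => // u _; rewrite subr_ge0; apply: z_max.
by rewrite -fz'; apply: IHp => // u _; rewrite fz'; apply: z_max.
Qed.

Lemma adj_connect_sym (G : sgraph) : connect_sym (@adj G).
Proof. exact/sym_connect_sym/adj_sym. Qed.

Section Automorphisms.

Variable G : sgraph.

Definition common_degree (x y : vertex G) : nat := #|[set z | adj x z && adj y z]|.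

Lemma leq_common_degree (x y : vertex G) (A : {set vertex G}) :
    (forall z, adj x z || adj y z -> z \in A) ->
  degree x + degree y <= common_degree x y + #|A|.
Proof.
move=> sub; rewrite /degree -cardsUI addnC; apply: leq_add; apply: subset_leq_card.
  by apply/subsetP => z; rewrite !inE.
by apply/subsetP => z; rewrite !inE; apply: sub.
Qed.

Variable s : {perm vertex G}.
Hypothesis s_aut : s \in graph_aut G.

Let s_adj : forall x y, adj (s x) (s y) = adj x y.
Proof. exact/graph_autP. Qed.

Lemma nbr_sum_aut (V : nmodType) (f : vertex G -> V) x :
  nbr_sum (@adj G) (f \o s) x = nbr_sum (@adj G) f (s x).
Proof.
by rewrite /nbr_sum [RHS](reindex_inj (@perm_inj _ s)); apply: eq_bigl => y; rewrite s_adj.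
Qed.

Lemma kernel_fun_aut (F : fieldType) (f : vertex G -> F) :
  kernel_fun f -> kernel_fun (f \o s).
Proof. by move=> ker_f x; rewrite nbr_sum_aut. Qed.

Lemma common_degree_aut x y : common_degree (s x) (s y) = common_degree x y.
Proof.
rewrite /common_degree -[LHS](card_preimset _ (@perm_inj _ s)).
by apply: eq_card => z; rewrite !inE !s_adj.
Qed.

End Automorphisms.

Section ColouredAutomorphisms.

Variables (G : sgraph) (C : eqType) (col : vertex G -> C).

Definition coloured_aut : {set {perm vertex G}} :=
  [set s in graph_aut G | [forall x, col (s x) == col x]].

Lemma coloured_autP (s : {perm vertex G}) :
  reflect ((forall x y, adj (s x) (s y) = adj x y) /\ (forall x, col (s x) = col x))
          (s \in coloured_aut).
Proof.
rewrite inE; apply: (iffP andP) => [] [s_aut s_col]; split.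
- exact/graph_autP.
- by move=> x; apply/eqP/(forallP s_col).
- exact/graph_autP.
- by apply/forallP => x; rewrite s_col.
Qed.

Lemma coloured_aut_group_set : group_set coloured_aut.
Proof.
apply/group_setP; split => [|s t /coloured_autP[s_adj s_col] /coloured_autP[t_adj t_col]].
  by apply/coloured_autP; split=> x *; rewrite !perm1.
by apply/coloured_autP; split=> x *; rewrite !permM ?t_adj ?t_col.
Qed.

Canonical coloured_aut_group : {group {perm vertex G}} := Group coloured_aut_group_set.

End ColouredAutomorphisms.

(** * Attaching gadgets to the vertices of a coloured graph *)

Lemma big_option (V : nmodType) (T : finType) (P : pred (option T)) (f : option T -> V) :
  (\sum_(o | P o) f o = (if P None then f None else 0) + \sum_(x | P (Some x)) f (Some x))%R.
Proof.
rewrite big_mkcond (bigD1 None) //=; congr (_ + _)%R; rewrite -big_mkcondr /=.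
rewrite (reindex_omap Some id) /= => [|[] //].
by apply: eq_bigl => x; rewrite eqxx andbT.
Qed.

Lemma big_pair (V : nmodType) (S T : finType) (P : pred (S * T)) (f : S * T -> V) :
  (\sum_(v | P v) f v = \sum_x \sum_(y | P (x, y)) f (x, y))%R.
Proof. by rewrite pair_big_dep; apply: eq_big => -[x y]. Qed.

Section GadgetFamilies.

Variables (C : Type) (U : finType) (port : pred U) (gadget : C -> rel U).

Record regular_gadgets (d k : nat) : Prop := RegularGadgets {
  gadget_degree : forall c u, #|[set u' | gadget c u u']| + port u = d;
  card_port : #|port| + k = d;
  port_nbr : forall c u, exists2 u', port u' & gadget c u u'
}.

(* With value 1 at the root, [h] satisfies the kernel equations inside the gadgets. *)
Record balanced_gadgets (k : nat) (R : nzRingType) (h : U -> R) : Prop := BalancedGadgets {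
  balance_neq0 : forall u, h u != 0%R;
  nbr_sum_balance : forall c u, nbr_sum (gadget c) h u = (- (port u)%:R)%R;
  sum_port_balance : (\sum_(u | port u) h u = - k%:R)%R;
  gadget_nonsingular : forall c (f : U -> R),
    (forall u, nbr_sum (gadget c) f u = 0%R) -> forall u, f u = 0%R
}.

Definition rigid_gadgets (T : Type) (h : U -> T) : Prop :=
  forall c c' (f : U -> U), injective f ->
    (forall u, h (f u) = h u) -> (forall u, port (f u) = port u) ->
    (forall u u', gadget c' (f u) (f u') = gadget c u u') ->
  c = c' /\ forall u, f u = u.

End GadgetFamilies.

Section Attach.

Variables (G : sgraph) (C : eqType) (col : vertex G -> C).
Variables (U : finType) (port : pred U) (gadget : C -> rel U).
Hypothesis gadget_sym : forall c, symmetric (gadget c).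
Hypothesis gadget_irr : forall c, irreflexive (gadget c).

Definition attach_adj (v v' : vertex G * option U) : bool :=
  match v.2, v'.2 with
  | None, None => adj v.1 v'.1
  | None, Some u | Some u, None => (v.1 == v'.1) && port u
  | Some u, Some u' => (v.1 == v'.1) && gadget (col v.1) u u'
  end.

Lemma attach_adj_sym : symmetric attach_adj.
Proof.
move=> [x [u|]] [x' [u'|]]; rewrite /attach_adj /= 1?[x == x']eq_sym ?[adj x x']adj_sym //.
by case: eqP => //= ->; rewrite gadget_sym.
Qed.

Lemma attach_adj_irr : irreflexive attach_adj.
Proof. by move=> [x [u|]]; rewrite /attach_adj /= ?adj_irr ?gadget_irr ?andbF. Qed.

Definition attach : sgraph := SGraph attach_adj_sym attach_adj_irr.

Lemma card_attach : #|vertex attach| = #|vertex G| * #|U|.+1.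
Proof. by rewrite card_prod card_option. Qed.

Lemma nbr_sum_root (V : nmodType) (f : vertex attach -> V) x :
  (nbr_sum (@adj attach) f (x, None)
   = nbr_sum (@adj G) (fun y => f (y, None)) x + \sum_(u | port u) f (x, Some u))%R.
Proof.
rewrite /nbr_sum big_pair; under eq_bigr do rewrite big_option.
rewrite big_split /= -big_mkcond; congr (_ + _)%R.
rewrite (bigD1 x) //= [X in (_ + X)%R]big1 ?addr0 => [|y /negbTE yx].
  by apply: eq_bigl => u; rewrite /attach_adj /= eqxx.
by rewrite big_pred0 // => u; rewrite /attach_adj /= eq_sym yx.
Qed.

Lemma nbr_sum_gadget (V : nmodType) (f : vertex attach -> V) x u :
  (nbr_sum (@adj attach) f (x, Some u)
   = (if port u then f (x, None) else 0)
     + nbr_sum (gadget (col x)) (fun u' => f (x, Some u')) u)%R.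
Proof.
rewrite /nbr_sum big_pair (bigD1 x) //= [X in (_ + X)%R]big1 ?addr0 => [|y /negbTE yx].
  by rewrite big_option /attach_adj /= eqxx.
by rewrite big_pred0 // => -[u'|]; rewrite /= /attach_adj /= eq_sym yx.
Qed.

Definition fibre_map (r : {perm vertex G}) (v : vertex attach) : vertex attach := (r v.1, v.2).

Lemma fibre_map_inj r : injective (fibre_map r).
Proof. by move=> [x o] [y o'] [/perm_inj-> ->]. Qed.

Definition fibre_perm (r : {perm vertex G}) : {perm vertex attach} :=
  perm (@fibre_map_inj r).

Lemma fibre_permM : {in [set: {perm vertex G}] &, {morph fibre_perm : r r' / (r * r')%g}}.
Proof. by move=> r r' _ _; apply/permP => v; rewrite permM !permE /fibre_map /= permM. Qed.

Canonical fibre_perm_morphism := Morphism fibre_permM.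

Lemma injm_fibre_perm : ('injm fibre_perm)%g.
Proof.
apply/injmP => r r' _ _ /permP eq_rr'; apply/permP => x.
by have := eq_rr' (x, None); rewrite !permE => -[].
Qed.

Lemma fibre_perm_aut r : r \in coloured_aut col -> fibre_perm r \in graph_aut attach.
Proof.
move=> /coloured_autP[r_adj r_col]; apply/graph_autP => -[x o] [y o']; rewrite !permE /=.
by rewrite /attach_adj /=; case: o o' => [u|] [u'|]; rewrite ?r_adj ?r_col ?(inj_eq perm_inj).
Qed.

Section RegularGadgets.

Variables (d k : nat).
Hypothesis G_regular : regular_graph k G.
Hypothesis gadgets_regular : regular_gadgets port gadget d k.

Lemma attach_regular : regular_graph d attach.
Proof.
move=> [x [u|]]; rewrite /degree -[LHS]natn -nbr_sum_const.
  rewrite nbr_sum_gadget nbr_sum_const natn [LHS]addrC.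
  by rewrite -[RHS](gadget_degree gadgets_regular (col x) u); case: (port u).
rewrite nbr_sum_root nbr_sum_const sumr_const !natn [LHS]addrC.
by rewrite [#|[set _ | _]|]G_regular; apply: (card_port gadgets_regular).
Qed.

Lemma attach_connected : connected_graph G -> connected_graph attach.
Proof.
move=> G_conn; have to_root x o : connect (@adj attach) (x, o) (x, None).
  case: o => [u|]; last exact: connect0.
  have [u' port_u' uu'] := port_nbr gadgets_regular (col x) u.
  by apply: (@connect_trans _ _ (x, Some u')); apply: connect1;
     rewrite /= /attach_adj /= eqxx.
have roots x y : connect (@adj attach) (x, None) (y, None).
  have /connectP[p pP ->] := G_conn x y.
  elim: p x pP => [|z p IHp] x /=; first by rewrite connect0.
  by case/andP => xz /IHp; apply: connect_trans; apply: connect1.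
move=> [x o] [y o'].
apply: connect_trans (to_root x o) _; apply: connect_trans (roots x y) _.
by rewrite adj_connect_sym.
Qed.

Section BalancedGadgets.

Variables (R : realFieldType) (h : U -> R).
Hypothesis G_connected : connected_graph G.
Hypothesis gadgets_balanced : balanced_gadgets port gadget k h.

Definition attach_vec (v : vertex attach) : R := if v.2 is Some u then h u else 1%R.

Lemma attach_vec_kernel : kernel_fun attach_vec.
Proof.
move=> [x [u|]].
  rewrite nbr_sum_gadget (nbr_sum_balance gadgets_balanced) /attach_vec /=.
  by case: (port u); rewrite ?subrr ?oppr0 ?addr0.
rewrite nbr_sum_root nbr_sum_const (sum_port_balance gadgets_balanced).
by rewrite [#|[set _ | _]|]G_regular subrr.
Qed.

Lemma kernel_fun_gadget (f : vertex attach -> R) x u :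
  kernel_fun f -> f (x, Some u) = (f (x, None) * h u)%R.
Proof.
move=> ker_f; apply/eqP; rewrite -subr_eq0; apply/eqP; move: u.
apply: (gadget_nonsingular gadgets_balanced (c := col x)) => u.
have := ker_f (x, Some u); rewrite nbr_sum_gadget => ker_xu.
rewrite /nbr_sum sumrB -mulr_sumr -/(nbr_sum _ h u) (nbr_sum_balance gadgets_balanced).
rewrite mulrN opprK -[RHS]ker_xu addrC; congr (_ + _)%R.
by case: (port u); rewrite ?mulr1 ?mulr0.
Qed.

Lemma kernel_fun_root (f : vertex attach -> R) x y :
  kernel_fun f -> f (x, None) = f (y, None).
Proof.
move=> ker_f; apply: (harmonic_const (f := fun z => f (z, None))) => // z.
have := ker_f (z, None); rewrite nbr_sum_root G_regular.
under [X in (_ + X)%R]eq_bigr do rewrite kernel_fun_gadget //.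
rewrite -mulr_sumr (sum_port_balance gadgets_balanced) mulrN mulr_natr.
by move/eqP; rewrite subr_eq0 => /eqP.
Qed.

Lemma attach_kernel_line (x0 : vertex G) (f : vertex attach -> R) :
  kernel_fun f -> forall v, f v = (f (x0, None) * attach_vec v)%R.
Proof.
move=> ker_f [x [u|]]; first by rewrite kernel_fun_gadget // (kernel_fun_root x x0).
by rewrite (kernel_fun_root x x0) // mulr1.
Qed.

Lemma attach_nut : 0 < #|vertex G| -> 0 < #|U| -> nut_graph R attach.
Proof.
move=> /card_gt0P[x0 _] U_gt0; apply: (nut_graph_of_kernel_fun _ attach_vec_kernel).
- rewrite card_attach; have G_gt0 : 0 < #|vertex G| by apply/card_gt0P; exists x0.
  by rewrite -[2]mul1n leq_mul.
- by move=> [x [u|]]; rewrite /attach_vec /= ?oner_eq0 ?(balance_neq0 gadgets_balanced).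
- by move=> f /(attach_kernel_line x0) fE; exists (f (x0, None)).
Qed.

(* Neighbours in a gadget have neighbourhoods of size [d] inside a fibre of size
   [#|U|.+1]; with the hypotheses below this leaves them more common neighbours
   than a root has with any of its neighbours. *)
Hypothesis few_ports : #|port| + #|U| < d.*2.
Hypothesis few_roots : k + #|U| < d.*2.
Hypothesis gadgets_rigid : rigid_gadgets port gadget h.

Definition strong_adj (v v' : vertex attach) : bool :=
  adj v v' && (d.*2 <= common_degree v v' + #|U|.+1).

Lemma strong_adj_gadget x u u' :
  strong_adj (x, Some u) (x, Some u') = gadget (col x) u u'.
Proof.
rewrite /strong_adj /= {1}/attach_adj /= eqxx; apply: andb_idr => _.
pose fibre := setX [set x] [set: option U].
have <- : #|fibre| = #|U|.+1 by rewrite cardsX cards1 cardsT card_option mul1n.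
rewrite -addnn -{1}(attach_regular (x, Some u)) -(attach_regular (x, Some u')).
apply: leq_common_degree => -[y o]; rewrite !inE andbT /= /attach_adj /= ![y == x]eq_sym.
by case: o => [?|] /orP[] /andP[/eqP<-].
Qed.

Lemma common_degree_root_gadget x u : port u ->
  common_degree ((x, None) : vertex attach) (x, Some u) < #|port|.
Proof.
move=> port_u; pose f u' : vertex attach := (x, Some u').
have f_inj : injective f by move=> u1 u2 [].
rewrite -(card_imset port f_inj); apply/proper_card/properP; split.
  apply/subsetP => -[y [u'|]]; rewrite inE /= /attach_adj /=.
    by case/andP => /andP[/eqP<- port_u'] _; apply: imset_f.
  by case/andP => xy /andP[/eqP yx _]; rewrite yx adj_irr in xy.
by exists (f u); [apply: imset_f | rewrite inE /= /attach_adj /= gadget_irr !andbF].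
Qed.

Lemma common_degree_roots x y : adj x y ->
  common_degree ((x, None) : vertex attach) (y, None) < k.
Proof.
move=> xy; pose f z : vertex attach := (z, None).
have f_inj : injective f by move=> z1 z2 [].
have <- : #|f @: [set z | adj x z]| = k by rewrite card_imset //; apply: G_regular.
apply/proper_card/properP; split.
  apply/subsetP => -[z [u|]]; rewrite inE /= /attach_adj /=.
    by case/andP => /andP[/eqP xz _] /andP[/eqP yz _]; rewrite xz yz adj_irr in xy.
  by case/andP => xz _; apply: imset_f; rewrite inE.
by exists (f y); [apply: imset_f; rewrite inE | rewrite inE /= /attach_adj /= adj_irr andbF].
Qed.

Lemma strong_adj_root x v : strong_adj (x, None) v = false.
Proof.
apply/negP => /andP[xv]; apply/negP; rewrite -ltnNge addnS -addSn.
case: v xv => y [u|] xv.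
  have [<- port_u] : x = y /\ port u by case/andP: xv => /eqP.
  by apply: leq_ltn_trans few_ports; rewrite leq_add2r; apply: common_degree_root_gadget.
by apply: leq_ltn_trans few_roots; rewrite leq_add2r; apply: common_degree_roots.
Qed.

Section AttachAutomorphism.

Variable s : {perm vertex attach}.
Hypothesis s_aut : s \in graph_aut attach.

Let s_adj : forall v v', adj (s v) (s v') = adj v v'.
Proof. exact/graph_autP. Qed.

Lemma attach_aut_root v : isSome (s v).2 = isSome v.2.
Proof.
have gadget_strong v' : isSome v'.2 = [exists v'', strong_adj v' v''].
  case: v' => x [u|] /=; last by apply/esym/existsP => -[v'']; rewrite strong_adj_root.
  have [u' _ uu'] := port_nbr gadgets_regular (col x) u.
  by apply/esym/existsP; exists (x, Some u'); rewrite strong_adj_gadget.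
have strong_aut v' v'' : strong_adj (s v') (s v'') = strong_adj v' v''.
  by rewrite /strong_adj s_adj common_degree_aut.
rewrite !gadget_strong; apply/existsP/existsP => -[v' vv'].
  by exists ((s^-1)%g v'); rewrite -strong_aut permKV.
by exists (s v'); rewrite strong_aut.
Qed.

Lemma attach_vec_aut v : attach_vec (s v) = attach_vec v.
Proof.
have ker_s : kernel_fun (attach_vec \o s) by apply: kernel_fun_aut attach_vec_kernel.
have s_root : attach_vec (s (v.1, None)) = 1%R.
  by have := attach_aut_root (v.1, None); rewrite /attach_vec; case: (s _).2.
by have /= := attach_kernel_line v.1 ker_s v; rewrite s_root mul1r.
Qed.

Definition root_aut (x : vertex G) : vertex G := (s (x, None)).1.

Lemma root_autE x : s (x, None) = (root_aut x, None).
Proof. by have := attach_aut_root (x, None); rewrite /root_aut; case: (s _) => y []. Qed.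

Lemma root_aut_gadget x u : exists u', s (x, Some u) = (root_aut x, Some u').
Proof.
have aut_port u' : port u' -> exists u'', s (x, Some u') = (root_aut x, Some u'').
  move=> port_u'; have := attach_aut_root (x, Some u').
  have := s_adj (x, None) (x, Some u'); rewrite root_autE; case: (s _) => y [u''|] //=.
  by rewrite /attach_adj /= eqxx port_u' => /andP[/eqP-> _] _; exists u''.
have [u' port_u' uu'] := port_nbr gadgets_regular (col x) u.
have [u'' su'] := aut_port u' port_u'.
have := attach_aut_root (x, Some u); have := s_adj (x, Some u') (x, Some u).
rewrite su'; case: (s _) => y [v|] //=.
by rewrite /attach_adj /= eqxx [gadget _ _ u]gadget_sym uu' => /andP[/eqP-> _] _; exists v.
Qed.

Lemma attach_aut_rigid x :
  col x = col (root_aut x) /\ forall u, s (x, Some u) = (root_aut x, Some u).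
Proof.
pose f u := odflt u (s (x, Some u)).2.
have sE u : s (x, Some u) = (root_aut x, Some (f u)).
  by rewrite /f; have [u' ->] := root_aut_gadget x u.
have [||||col_x f_id] := gadgets_rigid (c := col x) (c' := col (root_aut x)) (f := f).
- by move=> u u' fuu'; have /perm_inj[] : s (x, Some u) = s (x, Some u') by rewrite !sE fuu'.
- by move=> u; have := attach_vec_aut (x, Some u); rewrite sE.
- by move=> u; have := s_adj (x, None) (x, Some u);
     rewrite root_autE sE /= /attach_adj /= !eqxx.
- by move=> u u'; have := s_adj (x, Some u) (x, Some u');
     rewrite !sE /= /attach_adj /= !eqxx.
- by split=> // u; rewrite sE f_id.
Qed.

Lemma root_aut_inj : injective root_aut.
Proof.
move=> x y xy; have /perm_inj[//] : s (x, None) = s (y, None).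
by rewrite !root_autE xy.
Qed.

Lemma root_aut_coloured : perm root_aut_inj \in coloured_aut col.
Proof.
apply/coloured_autP; split=> [x y | x]; rewrite !permE.
  by have := s_adj (x, None) (y, None); rewrite !root_autE.
by have [] := attach_aut_rigid x.
Qed.

Lemma attach_autE : s = fibre_perm (perm root_aut_inj).
Proof.
apply/permP => -[x [u|]]; rewrite permE /fibre_map /= permE; last exact: root_autE.
by have [_] := attach_aut_rigid x.
Qed.

End AttachAutomorphism.

Lemma attach_aut_isog : graph_aut attach \isog coloured_aut col.
Proof.
rewrite isog_sym /=; suff <- : (fibre_perm @* coloured_aut col)%g = graph_aut attach.
  by rewrite sub_isog ?subsetT ?injm_fibre_perm.
apply/setP => s; apply/morphimP/idP => [[r _ r_aut ->] | s_aut].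
  exact: fibre_perm_aut.
exists (perm (root_aut_inj s_aut)); first exact: in_setT.
  exact: root_aut_coloured.
exact: attach_autE.
Qed.

End BalancedGadgets.

End RegularGadgets.

End Attach.

(** * Two linear recurrences *)

Section Recurrences.

Local Open Scope ring_scope.

Variables (V : comNzRingType) (s : nat -> V) (m : nat).

Lemma alternating_affine_rec :
    (forall k, (k < m)%N -> s k + s k.+1 *+ 2 + s k.+2 = 0) ->
  forall k, (k <= m.+1)%N -> s k = (-1) ^+ k * (s 0 - k%:R * (s 0 + s 1)).
Proof.
move=> rec; elim/ltn_ind => -[|[|k]] IHk km; first by rewrite mul0r subr0 mul1r.
  by rewrite mul1r mulN1r opprB addrAC subrr add0r.
have /eqP := rec k km; rewrite addrC addr_eq0 => /eqP ->.
by rewrite (IHk k) 1?(IHk k.+1) ?exprS; [ring | lia..].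
Qed.

Lemma antiperiodic_rec :
    (forall k, (k < m)%N -> s k + s k.+2 = 0) ->
  forall i j, (i + j.*2 <= m.+1)%N -> s (i + j.*2)%N = (-1) ^+ j * s i.
Proof.
move=> rec i; elim=> [|j IHj] ijm; first by rewrite addn0 mul1r.
rewrite doubleS !addnS exprS mulN1r mulNr -IHj; last lia.
by apply/eqP; rewrite -addr_eq0 addrC rec //; lia.
Qed.

End Recurrences.

(** * The gadgets *)

Lemma unit_steps_id n (f : nat -> nat) :
    (forall a, a.+1 < n -> f a.+1 = (f a).+1 \/ f a = (f a.+1).+1) ->
    (forall a b, a < n -> b < n -> f a = f b -> a = b) ->
  f 0 = 0 -> forall a, a < n -> f a = a.
Proof.
move=> f_step f_inj f0; elim/ltn_ind=> -[//|a] IHa a_lt.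
case: (f_step a a_lt) => [-> | fa]; first by rewrite IHa // ltnW.
rewrite IHa // in fa; last exact: ltnW.
case: a => [//|a] in IHa a_lt fa *.
have fa' : f a = a by apply: IHa => //; lia.
have := f_inj a.+2 a; lia.
Qed.

Lemma unit_steps_rev n (f : nat -> nat) :
    (forall a, a.+1 < n -> f a.+1 = (f a).+1 \/ f a = (f a.+1).+1) ->
    (forall a b, a < n -> b < n -> f a = f b -> a = b) ->
    (forall a, a < n -> f a < n) ->
  f 0 = n.-1 -> forall a, a < n -> f a = n.-1 - a.
Proof.
move=> f_step f_inj f_lt f0 a a_lt; have fa_lt := f_lt a a_lt.
suff rev_id : n.-1 - f a = a by lia.
apply: (@unit_steps_id n (fun b => n.-1 - f b)) a_lt => [b b_lt | b b' b_lt b'_lt fbb' |].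
- by have := f_step b b_lt; have := f_lt b; have := f_lt b.+1; lia.
- by apply: f_inj => //; have := f_lt b; have := f_lt b'; lia.
- by rewrite f0 subnn.
Qed.

Lemma sum_ord_notin (V : nmodType) n (r : seq nat) (u : nat -> V) :
  (\sum_(i < n | (i : nat) \notin r) u i + \sum_(a <- undup r | (a < n)%N) u a
   = \sum_(i < n) u i)%R.
Proof.
rewrite [RHS](bigID (fun i : 'I_n => (i : nat) \in r)) /= addrC; congr (_ + _)%R.
rewrite -(big_mkord (mem r)) -big_filter -[RHS]big_filter; apply: perm_big.
apply: uniq_perm; rewrite ?filter_uniq ?undup_uniq ?iota_uniq // => a.
by rewrite !mem_filter mem_undup mem_index_iota andbC.
Qed.

Definition parity_fun (V : Type) (p q : V) (a : nat) : V := if odd a then p else q.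

Lemma sum_parity (V : nmodType) (p q : V) n :
  (\sum_(i < n) parity_fun p q i = p *+ n./2 + q *+ uphalf n)%R.
Proof.
elim: n => [|n IHn]; first by rewrite big_ord0 !mulr0n addr0.
rewrite big_ord_recr /= IHn /parity_fun uphalf_half.
by case: odd; rewrite ?add0n !mulrSr !addrA // [LHS]addrAC (addrAC _ _ p).
Qed.

Definition tip (c : bool) : nat := if c then 4 else 6.

(* The unknowns outside the ladder: the positions up to 8, the centre [m] and the two
   last positions [e] and [e'], with [u 8] standing for both ends of the ladder and
   [N] for its length.  Elimination leaves [(N + 2) (m - u (tip (~~ c))) = 0]. *)
Lemma cap_system_eq0 (R : realFieldType) (c : bool) (N m e e' : R) (u : nat -> R) :
  (0 <= N ->
    u 0%N + u 1%N + u (tip c) = 0 -> u 0%N + u 1%N + u 2%N = 0 ->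
    u 1%N + u 2%N + u 3%N + e' = 0 -> u 2%N + u 3%N + u 4%N = 0 ->
    u (tip c).-1 + u (tip c) + u (tip c).+1 + u 0%N = 0 ->
    u (tip (~~ c)).-1 + u (tip (~~ c)) + u (tip (~~ c)).+1 + m = 0 ->
    u 4%N + u 5%N + u 6%N = 0 -> u 6%N + u 7%N + u 8%N = 0 ->
    u 8%N + e + e' = 0 -> e + e' + u 2%N = 0 ->
    u 8%N *+ 2 = m *+ 2 - N * (m - u (tip (~~ c))) ->
    u 7%N + e = (N + 1) * (m - u (tip (~~ c))) - m *+ 2 ->
  [/\ m = 0, e = 0, e' = 0 & forall a, (a <= 8)%N -> u a = 0])%R.
Proof.
move=> N_ge0; set v := u (tip (~~ c)).
move=> at0 at1 at2 at3 at_tip at_cotip at5 at7 at_e at_e' ladder_even ladder_odd.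
have defect0 : (m - v = 0)%R.
  have /eqP : ((N + 2) * (m - v) = 0)%R.
    by move: at0 at_tip at_cotip ladder_even ladder_odd; rewrite /v /tip; case: (c) => /=; lra.
  by rewrite mulf_eq0 => /orP[/eqP|/eqP //]; lra.
rewrite defect0 !mulr0 in ladder_even ladder_odd.
have [m0 e0 e'0] : [/\ m = 0, e = 0 & e' = 0]%R.
  by move: at0 at_tip at_cotip defect0; rewrite /v /tip; case: (c) => /=; split; lra.
split=> //; rewrite /v /tip in at0 at_tip at_cotip defect0.
do 9?[case=> [_|]] => //; move: at0 at_tip at_cotip defect0; case: (c) => /=; lra.
Qed.

Section LadderGadget.

Variable t : nat.
Hypothesis t_gt1 : 1 < t.

Local Notation n := (4 * t).+3.
Local Notation centre := (2 * t + 4).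

(* The complement of the gadget of colour [c] is the path 0, 1, ..., 4 t + 2 with the
   chords [a -- mate c a]; unmatched positions are their own mates.  The chords
   [centre - k -- centre + k] fold the path into a ladder. *)
Definition mate (c : bool) (a : nat) : nat :=
  if a == 0 then tip c else if a == tip c then 0
  else if a == tip (~~ c) then centre else if a == centre then tip (~~ c)
  else if a == 2 then 4 * t + 2 else if a == 4 * t + 2 then 2
  else if 8 <= a <= 4 * t then 4 * t + 8 - a else a.

(* A list of positions below [4 t + 3]: neither the repeated [0.-1 = 0] nor the
   successor of the last position matters. *)
Definition closed_conbrs (c : bool) (a : nat) : seq nat := [:: mate c a; a.-1; a.+1; a].

Definition ladder_gadget (c : bool) : rel 'I_n :=
  fun a b => (b : nat) \notin closed_conbrs c a.

Definition ladder_nonports : seq nat := [:: 0; 1; 3; 5; 7; 4 * t + 1; 4 * t + 2].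

Definition ladder_port : pred 'I_n := fun a => (a : nat) \notin ladder_nonports.

Lemma mate_lt c a : a < n -> mate c a < n.
Proof. rewrite /mate /tip; case: c => /=; do !case: ifP => /=; lia. Qed.

Lemma mateK c a : a < n -> mate c (mate c a) = a.
Proof. rewrite /mate /tip; case: c => /=; do !case: ifP => /=; lia. Qed.

Lemma odd_mate c a : odd (mate c a) = odd a.
Proof. rewrite /mate /tip; case: c => /=; do !case: ifP => /=; lia. Qed.

Lemma mate_fix c a : a < n -> (mate c a == a) = (a \in [:: 1; 3; 5; 7; 4 * t + 1]).
Proof. rewrite /mate /tip !inE; case: c => /=; do !case: ifP => /=; lia. Qed.

Lemma mate_tip c : mate c (tip c) = 0 /\ mate c (tip (~~ c)) = centre.
Proof. by split; rewrite /mate /tip; case: c => /=; rewrite ?eqxx. Qed.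

Lemma mate_end c : mate c 2 = 4 * t + 2 /\ mate c (4 * t + 2) = 2.
Proof. by split; rewrite /mate /tip; case: c => /=; do ?case: ifP => /=; lia. Qed.

Lemma mate_centre c : mate c centre = tip (~~ c).
Proof. rewrite /mate /tip; case: c => /=; do !case: ifP => /=; lia. Qed.

Lemma mate_ladder c k : 0 < k <= 2 * t - 4 ->
  mate c (centre - k) = centre + k /\ mate c (centre + k) = centre - k.
Proof.
by move=> k_range; split; rewrite /mate /tip; case: c => /=; do !case: ifP => /=; lia.
Qed.

Lemma ladder_gadget_sym c : symmetric (ladder_gadget c).
Proof.
move=> a b; have [aK bK] := (mateK c (ltn_ord a), mateK c (ltn_ord b)).
rewrite /ladder_gadget !inE; congr (~~ _).
have -> : (b == mate c a :> nat) = (a == mate c b :> nat).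
  by apply/eqP/eqP => [->|->]; rewrite ?aK ?bK.
by congr (_ || _); lia.
Qed.

Lemma ladder_gadget_irr c : irreflexive (ladder_gadget c).
Proof. by move=> a; rewrite /ladder_gadget !inE eqxx !orbT. Qed.

Lemma ladder_gadget_path c (a b : 'I_n) : odd a != odd b ->
  ladder_gadget c a b = (a.+1 != b) && (b.+1 != a).
Proof. have := odd_mate c a; rewrite /ladder_gadget !inE; lia. Qed.

Section Sums.

Variable V : nmodType.

Definition closed_sum (c : bool) (u : nat -> V) (a : nat) : V :=
  (\sum_(b <- undup (closed_conbrs c a) | (b < n)%N) u b)%R.

Lemma ladder_gadget_sum c (u : nat -> V) (a : 'I_n) :
  (nbr_sum (ladder_gadget c) (fun b => u b) a + closed_sum c u a = \sum_(b < n) u b)%R.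
Proof. exact: sum_ord_notin. Qed.

Lemma closed_sumE c (u : nat -> V) a : a < n ->
  (closed_sum c u a = (if mate c a == a then 0 else u (mate c a))
    + ((if a == 0%N then 0 else u a.-1) + ((if (a.+1 < n)%N then u a.+1 else 0) + u a)))%R.
Proof.
move=> a_lt; have [odd_m m_lt] := (odd_mate c a, mate_lt c a_lt).
have m_gt0 : a = 0 -> 0 < mate c a by move=> ->; rewrite /mate /tip; case: (c).
rewrite /closed_sum /closed_conbrs /= !inE.
rewrite (_ : [|| _, _ | _] = (mate c a == a)); last lia.
rewrite (_ : (_ || _) = (a == 0)); last lia.
rewrite (_ : (a.+1 == a) = false); last lia.
have p_lt : a.-1 < n by lia.
by case: (mate c a == a); case: (a == 0); rewrite !big_cons big_nil ?m_lt ?p_lt ?a_lt;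
  case: ifP; rewrite ?add0r ?addr0.
Qed.

End Sums.

Section ParitySums.

Variables (V : comNzRingType) (p q : V).

Lemma closed_sum_parity c (a : 'I_n) :
  (closed_sum c (parity_fun p q) a = q *+ 2 + p *+ (ladder_port a).+1)%R.
Proof.
have a_lt := ltn_ord a; rewrite closed_sumE // mate_fix // /parity_fun odd_mate.
rewrite /ladder_port /ladder_nonports !inE; have [odd_a | even_a] := boolP (odd a).
  have [-> -> -> ->] : [/\ (a == 0 :> nat) = false, a.+1 < n, odd a.-1 = false
    & odd a.+1 = false] by split; lia.
  case: ifP => fix_a; first by rewrite (_ : ~~ _ = false) /=; [ring | lia].
  by rewrite (_ : ~~ _ = true) /=; [ring | lia].
rewrite (_ : [|| _, _ | _] = false); last lia.
have [a0|a_gt0] := eqVneq (a : nat) 0; first by rewrite a0 /=; ring.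
have [-> ->] : odd a.-1 /\ odd a.+1 by lia.
case: ltnP => a_last; first by rewrite (_ : ~~ _ = true) /=; [ring | lia].
by rewrite (_ : ~~ _ = false) /=; [ring | lia].
Qed.

Lemma ladder_gadget_parity_sum c (a : 'I_n) :
  (nbr_sum (ladder_gadget c) (fun b => parity_fun p q b) a
   = p *+ (2 * t - ladder_port a) + q *+ (2 * t))%R.
Proof.
apply: (addIr (closed_sum c (parity_fun p q) a)).
rewrite ladder_gadget_sum sum_parity closed_sum_parity [(q *+ 2 + _)%R]addrC addrACA -!mulrnDr.
by congr (_ *+ _ + _ *+ _)%R; lia.
Qed.

Lemma ladder_port_parity_sum :
  (\sum_(a | ladder_port a) parity_fun p q a = p *+ (2 * t - 4) + q *+ (2 * t))%R.
Proof.
have := sum_ord_notin n ladder_nonports (parity_fun p q).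
have -> : undup ladder_nonports = ladder_nonports by apply: undup_id; rewrite /= !inE; lia.
have -> : (\sum_(a <- ladder_nonports | (a < n)%N) parity_fun p q a = p *+ 5 + q *+ 2)%R.
  have [odd1 odd2] : odd (4 * t + 1) = true /\ odd (4 * t + 2) = false by lia.
  by rewrite big_mkcond !big_cons big_nil /parity_fun odd1 odd2 /= !ifT; [ring | lia..].
rewrite sum_parity => portsE; apply: (addIr (p *+ 5 + q *+ 2)%R).
by rewrite portsE addrACA -!mulrnDr; congr (_ *+ _ + _ *+ _)%R; lia.
Qed.

End ParitySums.

Lemma ladder_gadgets_regular : regular_gadgets ladder_port ladder_gadget (4 * t) 4.
Proof.
have parity_fun1 a : (parity_fun 1 1 a = 1 :> int)%R by rewrite /parity_fun if_same.
split=> [c a||c a].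
- have := ladder_gadget_parity_sum 1%R (1%R : int) c a.
  rewrite /nbr_sum; under eq_bigr do rewrite parity_fun1.
  rewrite -/(nbr_sum _ _ _) nbr_sum_const -mulrnDr !natz; case: (ladder_port a) => /=; lia.
- have := ladder_port_parity_sum 1%R (1%R : int); under eq_bigr do rewrite parity_fun1.
  by rewrite sumr_const -mulrnDr !natz => -[portE]; rewrite [#|ladder_port|]portE; lia.
have [b b_lt /andP[port_b ab]] : exists2 b, b < n &
    (b \notin ladder_nonports) && (b \notin closed_conbrs c a).
  have : [|| 2 \notin closed_conbrs c a, 4 \notin closed_conbrs c a
    | 6 \notin closed_conbrs c a] by have := odd_mate c a; rewrite !inE; lia.
  by case/or3P => ab; [exists 2 | exists 4 | exists 6]; rewrite ?ab ?andbT ?inE; lia.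
by exists (Ordinal b_lt).
Qed.

Section ComplementKernel.

Local Open Scope ring_scope.

Variables (R : realFieldType) (c : bool) (u : nat -> R).
Hypothesis closed0 : forall a, (a < n)%N -> closed_sum c u a = 0.

Lemma unmatched_eq0 a :
  (0 < a)%N -> (a.+1 < n)%N -> mate c a = a -> u a.-1 + u a + u a.+1 = 0.
Proof.
move=> a_gt0 a_lt m_fix; rewrite -[RHS](closed0 (ltnW a_lt)) closed_sumE; last exact: ltnW.
by rewrite m_fix eqxx a_lt eqn0Ngt a_gt0 /=; ring.
Qed.

Lemma matched_eq0 a : (0 < a)%N -> (a.+1 < n)%N -> mate c a != a ->
  u a.-1 + u a + u a.+1 + u (mate c a) = 0.
Proof.
move=> a_gt0 a_lt m_neq; rewrite -[RHS](closed0 (ltnW a_lt)) closed_sumE; last exact: ltnW.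
by rewrite (negbTE m_neq) a_lt eqn0Ngt a_gt0 /=; ring.
Qed.

Lemma ladder_rungs k : (k < 2 * t - 4)%N ->
  u (centre - k)%N + u (centre - k.+1)%N + u (centre - k.+2)%N + u (centre + k.+1)%N = 0 /\
  u (centre + k)%N + u (centre + k.+1)%N + u (centre + k.+2)%N + u (centre - k.+1)%N = 0.
Proof.
move=> k_lt; have [|mateL mateR] := @mate_ladder c k.+1; first lia.
have := @matched_eq0 (centre - k.+1)%N; have := @matched_eq0 (centre + k.+1)%N.
rewrite mateL mateR.
have -> : (centre - k.+1).-1 = (centre - k.+2)%N by lia.
have -> : (centre - k.+1).+1 = (centre - k)%N by lia.
have -> : (centre + k.+1).-1 = (centre + k)%N by lia.
have -> : (centre + k.+1).+1 = (centre + k.+2)%N by lia.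
move=> right0 left0; split; first by rewrite -left0; [ring | lia..].
by rewrite -right0; [ring | lia..].
Qed.

Definition ladder_sum (k : nat) : R := u (centre - k)%N + u (centre + k)%N.
Definition ladder_diff (k : nat) : R := u (centre - k)%N - u (centre + k)%N.

Lemma ladder_sumE k : (k <= 2 * t - 3)%N ->
  ladder_sum k = (-1) ^+ k * (ladder_sum 0 - k%:R * (ladder_sum 0 + ladder_sum 1)).
Proof.
move=> k_le; apply: (@alternating_affine_rec _ _ (2 * t - 4)); last lia.
by move=> j /ladder_rungs[]; rewrite /ladder_sum; lra.
Qed.

Lemma ladder_diffE i j : (i + j.*2 <= 2 * t - 3)%N ->
  ladder_diff (i + j.*2) = (-1) ^+ j * ladder_diff i.
Proof.
move=> ij_le; apply: (@antiperiodic_rec _ _ (2 * t - 4)); last lia.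
by move=> k /ladder_rungs[]; rewrite /ladder_diff; lra.
Qed.

Definition ladder_slope : R := u centre - u (tip (~~ c)).

Lemma ladder_sum01 :
  ladder_sum 0 = u centre *+ 2 /\ ladder_sum 0 + ladder_sum 1 = ladder_slope.
Proof.
have sum0 : ladder_sum 0 = u centre *+ 2 by rewrite /ladder_sum subn0 addn0 mulr2n.
split=> //; have tip_lt : tip (~~ c) != centre by rewrite /tip; case: (c) => /=; lia.
have := @matched_eq0 centre; rewrite mate_centre => /(_ _ _ tip_lt) centre0.
rewrite sum0 /ladder_sum /ladder_slope addn1 subn1; apply/eqP; rewrite -subr_eq0; apply/eqP.
by rewrite -centre0; [ring | lia..].
Qed.

Lemma ladder_ends :
  [/\ u 8%N = u (4 * t)%N,
      u 8%N + u (4 * t)%N = u centre *+ 2 - (2 * t - 4)%:R * ladder_slope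
    & u 7%N + u (4 * t + 1)%N = (2 * t - 3)%:R * ladder_slope - u centre *+ 2].
Proof.
have [sum0 sum01] := ladder_sum01.
have [even_lt odd_lt] : (2 * t - 4 <= 2 * t - 3)%N /\ (2 * t - 3 <= 2 * t - 3)%N by lia.
have := ladder_diffE (i := 0) (j := t - 2); have := ladder_sumE odd_lt.
have := ladder_sumE even_lt; rewrite sum01 sum0 /ladder_sum /ladder_diff.
have -> : (0 + (t - 2).*2)%N = (2 * t - 4)%N by lia.
have -> : (centre - (2 * t - 4))%N = 8 by lia.
have -> : (centre + (2 * t - 4))%N = (4 * t)%N by lia.
have -> : (centre - (2 * t - 3))%N = 7 by lia.
have -> : (centre + (2 * t - 3))%N = (4 * t + 1)%N by lia.
rewrite -[(-1) ^+ (2 * t - 4)]signr_odd -[(-1) ^+ (2 * t - 3)]signr_odd.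
have -> : odd (2 * t - 4) = false by lia.
have -> : odd (2 * t - 3) = true by lia.
rewrite subn0 addn0 subrr mulr0 mul1r mulN1r opprB => -> -> /(_ even_lt) /eqP.
by rewrite subr_eq0 => /eqP.
Qed.

Lemma cap_eq0 :
  [/\ u centre = 0, u (4 * t + 1)%N = 0, u (4 * t + 2)%N = 0
    & forall a, (a <= 8)%N -> u a = 0].
Proof.
have [[tip_mate cotip_mate] [mate2 mate_last]] := (mate_tip c, mate_end c).
have at0 : u 0%N + u 1%N + u (tip c) = 0.
  have := closed0 (ltn0Sn _); rewrite closed_sumE // [mate c 0]/= /tip.
  by case: (c) => /=; lra.
have at_last : u (4 * t + 1)%N + u (4 * t + 2)%N + u 2%N = 0.
  have := @closed0 (4 * t + 2)%N; rewrite closed_sumE ?mate_last; last lia.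
  rewrite (_ : (4 * t + 2).-1 = 4 * t + 1)%N ?ifF; [| lia..].
  by move=> <-; [ring | lia].
have at_odd a : a \in [:: 1; 3; 5; 7; 4 * t + 1]%N -> u a.-1 + u a + u a.+1 = 0.
  move=> a_odd; have a_lt : (a < n)%N by move: a_odd; rewrite !inE; lia.
  by apply: unmatched_eq0; [| |apply/eqP; rewrite mate_fix //]; move: a_odd; rewrite !inE; lia.
have at_even a : a \in [:: 2; 4; 6]%N -> u a.-1 + u a + u a.+1 + u (mate c a) = 0.
  move=> a_even; apply: matched_eq0; rewrite ?mate_fix; move: a_even; rewrite !inE; lia.
have tip_even b : tip b \in [:: 2; 4; 6]%N by rewrite /tip; case: b.
have := at_even _ (tip_even c); have := at_even _ (tip_even (~~ c)).
have := at_even 2%N isT; rewrite tip_mate cotip_mate mate2 => at2 at_cotip at_tip.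
have := at_odd (4 * t + 1)%N; rewrite !inE eqxx !orbT => /(_ isT).
have -> : (4 * t + 1).-1 = (4 * t)%N by lia.
have -> : (4 * t + 1).+1 = (4 * t + 2)%N by lia.
have [end_eq even_end odd_end] := ladder_ends.
rewrite -end_eq => at_prelast.
apply: (cap_system_eq0 (c := c) (N := (2 * t - 4)%:R) (ler0n R _)) => //.
- exact: (at_odd 1%N).
- exact: (at_odd 3).
- exact: (at_odd 5).
- exact: (at_odd 7).
- by rewrite mulr2n {2}end_eq.
- by rewrite odd_end; congr (_ * _ - _); rewrite natr1; congr _%:R; lia.
Qed.

Lemma closed_sum_eq0 a : (a < n)%N -> u a = 0.
Proof.
move=> a_lt; have [m0 e0 e'0 cap0] := cap_eq0.
have [sum0 sum01] := ladder_sum01.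
have sum_zero k : (k <= 2 * t - 3)%N -> ladder_sum k = 0.
  move=> /ladder_sumE ->; rewrite sum01 sum0 /ladder_slope m0.
  by rewrite cap0 ?mul0rn ?(subrr, mulr0) //; rewrite /tip; case: (c).
have diff_zero k : (k <= 2 * t - 3)%N -> ladder_diff k = 0.
  move=> k_le; suff diff_odd : ladder_diff (odd k) = 0.
    by rewrite -[k]odd_double_half ladder_diffE ?odd_double_half // diff_odd mulr0.
  case: (odd k); last by rewrite /ladder_diff subn0 addn0 subrr.
  have := ladder_diffE (i := 1) (j := t - 2); rewrite (_ : 1 + _ = 2 * t - 3)%N; last lia.
  rewrite {1}/ladder_diff.
  have -> : (centre - (2 * t - 3))%N = 7 by lia.
  have -> : (centre + (2 * t - 3))%N = (4 * t + 1)%N by lia.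
  rewrite e0 cap0 // subrr => /(_ (leqnn _))/esym/eqP.
  by rewrite mulf_eq0 signr_eq0 => /eqP.
have ladder0 k : (k <= 2 * t - 3)%N -> u (centre - k)%N = 0 /\ u (centre + k)%N = 0.
  move=> k_le; have := sum_zero k k_le; have := diff_zero k k_le.
  by rewrite /ladder_sum /ladder_diff => diff_k sum_k; split; lra.
have [/cap0 //|a_gt8] := leqP a 8.
have [->//|a_neq] := eqVneq a (4 * t + 2)%N.
have [a_le|a_gt] := leqP a centre.
  by have [|+ _] := ladder0 (centre - a)%N; [lia | rewrite subKn].
by have [|_ +] := ladder0 (a - centre)%N; [lia | rewrite subnKC // ltnW].
Qed.

End ComplementKernel.

Lemma ladder_gadget_nonsingular (R : realFieldType) c (f : 'I_n -> R) :
  (forall a, nbr_sum (ladder_gadget c) f a = 0)%R -> forall a, f a = 0%R.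
Proof.
move=> f0; pose u a := f (inord a); pose total := (\sum_(a < n) u a)%R.
pose e := parity_fun 0%R (total / 2)%R.
have closed_u (a : 'I_n) : closed_sum c u a = total.
  rewrite /total -(ladder_gadget_sum c u a) -[LHS]add0r -(f0 a); congr (_ + _)%R.
  by apply: eq_bigr => b _; rewrite /u inord_val.
have closed_e (a : 'I_n) : closed_sum c e a = total by rewrite closed_sum_parity; lra.
have u_e (a : 'I_n) : u a = e a.
  apply/eqP; rewrite -subr_eq0; apply/eqP.
  apply: (closed_sum_eq0 (c := c) (u := fun a => (u a - e a)%R)) => // b b_lt.
  rewrite /closed_sum sumrB -[X in (X - _)%R]/(closed_sum c u (Ordinal b_lt)).
  by rewrite -[X in (_ - X)%R]/(closed_sum c e (Ordinal b_lt)) closed_u closed_e subrr.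
have total0 : total = 0%R.
  have totalE : (total = total / 2 * (2 * t + 2)%:R)%R.
    rewrite mulr_natr {1}/total (eq_bigr (fun a : 'I_n => e a)) // sum_parity mul0rn add0r.
    by congr (_ *+ _)%R; lia.
  have /eqP : (total * t%:R = 0)%R by move: totalE; rewrite natrD natrM; lra.
  by rewrite mulf_eq0 pnatr_eq0 => /orP[/eqP //|]; lia.
by move=> a; rewrite -(inord_val a) -/(u a) u_e /e total0 mul0r /parity_fun if_same.
Qed.

Definition parity_sign (R : nzRingType) (a : 'I_n) : R := parity_fun 1%R (-1)%R a.

Lemma ladder_gadgets_balanced (R : realFieldType) :
  balanced_gadgets ladder_port ladder_gadget 4 (@parity_sign R).
Proof.
split=> [a|c a||c f f0].
- by rewrite /parity_sign /parity_fun; case: odd; rewrite ?oppr_eq0 oner_eq0.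
- rewrite [LHS]ladder_gadget_parity_sum mulNrn; case: (ladder_port a) => /=.
    by rewrite -[in X in (_ - X)%R](subnK (_ : 1 <= 2 * t)) ?natrD; [ring | lia].
  by rewrite subn0 subrr oppr0.
- rewrite [LHS]ladder_port_parity_sum mulNrn.
  by rewrite -[in X in (_ - X)%R](subnK (_ : 4 <= 2 * t)) ?natrD; [ring | lia].
- exact: ladder_gadget_nonsingular f0.
Qed.

Lemma parity_sign_odd (R : numDomainType) (a b : 'I_n) :
  parity_sign R a = parity_sign R b -> odd a = odd b.
Proof.
rewrite /parity_sign /parity_fun; case: odd; case: odd => // /eqP.
  by rewrite -addr_eq0 -mulr2n pnatr_eq0.
by rewrite eq_sym -addr_eq0 -mulr2n pnatr_eq0.
Qed.

Lemma ladder_gadget_consecutive c c' (f : 'I_n -> 'I_n) (a b : 'I_n) :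
    (forall a, odd (f a) = odd a) ->
    (forall a b, ladder_gadget c' (f a) (f b) = ladder_gadget c a b) ->
  b = a.+1 :> nat -> f b = (f a).+1 :> nat \/ f a = (f b).+1 :> nat.
Proof.
move=> odd_f f_adj ab; have := f_adj a b.
by rewrite !ladder_gadget_path ?odd_f ab //=; lia.
Qed.

(* Opposite parity makes the path of the complement visible, and the two ends of
   the path are told apart by their mates, [tip c] and [2]. *)
Lemma ladder_gadgets_rigid (R : numDomainType) :
  rigid_gadgets ladder_port ladder_gadget (@parity_sign R).
Proof.
move=> c c' f f_inj f_sign f_port f_adj.
have odd_f a : odd (f a) = odd a by apply: parity_sign_odd (f_sign a).
pose g a : nat := f (inord a).
have g_lt a : g a < n by apply: ltn_ord.
have g_inj a b : a < n -> b < n -> g a = g b -> a = b.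
  by move=> a_lt b_lt /val_inj/f_inj/(congr1 val); rewrite /= !inordK.
have g_step a : a.+1 < n -> g a.+1 = (g a).+1 \/ g a = (g a.+1).+1.
  move=> a_lt; apply: (ladder_gadget_consecutive odd_f f_adj).
  by rewrite !inordK // ltnW.
have tip_lt : tip c < n by rewrite /tip; case: (c); lia.
have g_tip : g (tip c) \in closed_conbrs c' (g 0).
  apply/negbNE; rewrite -[_ \notin _]/(ladder_gadget c' (f _) (f _)) f_adj.
  by rewrite /ladder_gadget !inordK // !inE eqxx.
have [g0|g0] : g 0 = 0 \/ g 0 = n.-1.
- have := odd_f (inord 0); have := f_port (inord 0); have := g_lt 0.
  by rewrite /ladder_port /ladder_nonports -/(g 0) !inE !inordK //=; lia.
- have g_id := unit_steps_id g_step g_inj g0; split.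
    by move: g_tip; rewrite !g_id // /tip !inE; case: (c) (c') => -[].
  by move=> a; apply: val_inj; rewrite /= -[RHS]g_id // /g inord_val.
have g_rev := unit_steps_rev g_step g_inj (fun a _ => g_lt a) g0.
exfalso; move: g_tip; rewrite !g_rev // subn0 !inE /= -[(4 * t).+2]addn2.
by have [_ ->] := mate_end c'; rewrite /tip; case: (c); lia.
Qed.

End LadderGadget.

(** * Voltage covers of the square of a cycle *)

Lemma val_addZp q (i : 'Z_q) k : 1 < q -> k < q ->
  (i + k%:R)%R = (if i + k < q then i + k else i + k - q) :> nat.
Proof.
case: q i => [|[|q]] // i _ k_lt; have i_lt : i < q.+2 := ltn_ord i.
rewrite /= Zp_nat /= modnDmr; move: (nat_of_ord i) i_lt => {}i i_lt.
case: ltnP => [ik_lt | ik_ge]; first by rewrite modn_small.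
by rewrite -{1}(subnK ik_ge) modnDr modn_small //; lia.
Qed.

Lemma map_uniq_inj (S T : eqType) (f : S -> T) (r : seq S) :
  uniq (map f r) -> {in r &, injective f}.
Proof.
elim: r => //= z r IHr /andP[zr r_uniq] x y; rewrite !inE.
move=> /predU1P[->|xr] /predU1P[->|yr] // fxy; last exact: IHr r_uniq _ _ xr yr fxy.
  by rewrite fxy map_f in zr.
by rewrite -fxy map_f in zr.
Qed.

Section Cover.

Variables (gT : finGroupType) (q : nat) (volt : 'Z_q -> gT).
Hypothesis q_ge12 : 12 <= q.

Let ltn_Zq (i : 'Z_q) : i < q.
Proof. by have := ltn_ord i; rewrite {2}Zp_cast //; lia. Qed.

Definition shifts (i : 'Z_q) : seq 'Z_q := [:: i + 1; i - 1; i + 2; i - 2]%R.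

Lemma val_shifts (i : 'Z_q) :
  [/\ (i + 1)%R = (if i.+1 < q then i.+1 else 0) :> nat,
      (i - 1)%R = (if i == 0 :> nat then q.-1 else i.-1) :> nat,
      (i + 2)%R = (if i.+2 < q then i.+2 else i.+2 - q) :> nat
    & (i - 2)%R = (if i < 2 then i + q - 2 else i - 2) :> nat].
Proof.
have add1 (j : 'Z_q) : (j + 1)%R = (if j.+1 < q then j.+1 else 0) :> nat.
  rewrite -[1%R]/(1%:R)%R val_addZp ?addn1; [|lia..].
  by have := ltn_Zq j; case: ifP => //; lia.
have add2 (j : 'Z_q) : (j + 2)%R = (if j.+2 < q then j.+2 else j.+2 - q) :> nat.
  by rewrite val_addZp ?addn2; [|lia..].
split=> //.
  by have := add1 (i - 1)%R; rewrite subrK; have := ltn_Zq (i - 1)%R; do 2!case: ifP; lia.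
by have := add2 (i - 2)%R; rewrite subrK; have := ltn_Zq (i - 2)%R; do 2!case: ifP; lia.
Qed.

Lemma shifts_uniq i : uniq (i :: shifts i).
Proof.
rewrite /shifts; have := val_shifts i.
move: (i + 1)%R (i - 1)%R (i + 2)%R (i - 2)%R (ltn_Zq i) => a b c d i_lt [ea eb ec ed].
rewrite [uniq _]/= !inE -!val_eqE /= ea eb ec ed; do 4!case: ifP; lia.
Qed.

Definition volt_arc (v w : gT * 'Z_q) : bool :=
  (w == (v.1, v.2 + 1)%R) || (w == ((v.1 * volt v.2)%g, (v.2 + 2)%R)).

Definition cover_adj (v w : gT * 'Z_q) : bool := volt_arc v w || volt_arc w v.

Definition cover_nbrs (v : gT * 'Z_q) : seq (gT * 'Z_q) :=
  [:: (v.1, v.2 + 1); (v.1, v.2 - 1); ((v.1 * volt v.2)%g, v.2 + 2);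
      ((v.1 * (volt (v.2 - 2))^-1)%g, v.2 - 2)]%R.

Lemma cover_adjE v w : cover_adj v w = (w \in cover_nbrs v).
Proof.
case: v w => g i [h j]; rewrite /cover_adj /volt_arc /cover_nbrs !inE /= !xpair_eqE.
have -> : (i == j + 1)%R = (j == i - 1)%R by rewrite -subr_eq eq_sym.
have -> : (i == j + 2)%R = (j == i - 2)%R by rewrite -subr_eq eq_sym.
rewrite [g == h]eq_sym -orbA; congr (_ || _); rewrite orbCA; congr (_ || (_ || _)).
by case: (j =P _) => [->|]; rewrite ?andbF // eq_sym (can2_eq (mulgK _) (mulgKV _)).
Qed.

Lemma map_snd_cover_nbrs v : map snd (cover_nbrs v) = shifts v.2.
Proof. by []. Qed.

Lemma cover_adj_sym : symmetric cover_adj.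
Proof. by move=> v w; rewrite /cover_adj orbC. Qed.

Lemma cover_adj_shift v w : cover_adj v w -> w.2 \in shifts v.2.
Proof. by rewrite cover_adjE -map_snd_cover_nbrs; apply: map_f. Qed.

Lemma cover_adj_irr : irreflexive cover_adj.
Proof.
move=> v; apply/negP => /cover_adj_shift.
by have /andP[/negbTE->] := shifts_uniq v.2.
Qed.

Definition cover : sgraph := SGraph cover_adj_sym cover_adj_irr.

Lemma cover_nbrs_uniq v : uniq (map snd (cover_nbrs v)).
Proof. by have /andP[] := shifts_uniq v.2. Qed.

Lemma card_cover_nbrs v (P : pred (gT * 'Z_q)) :
  #|[set w | cover_adj v w & P w]| = count P (cover_nbrs v).
Proof.
rewrite -size_filter -(card_uniqP (filter_uniq _ (map_uniq (cover_nbrs_uniq v)))).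
by apply: eq_card => w; rewrite inE mem_filter cover_adjE andbC.
Qed.

Lemma cover_regular : regular_graph 4 cover.
Proof.
move=> v; rewrite -[RHS](count_predT (cover_nbrs v)) -card_cover_nbrs.
by apply: eq_card => w; rewrite !inE andbT.
Qed.

Lemma cover_adj_inj v w w' : cover_adj v w -> cover_adj v w' -> w.2 = w'.2 -> w = w'.
Proof. by rewrite !cover_adjE; apply: (map_uniq_inj (cover_nbrs_uniq v)). Qed.

Lemma shifts_sym (i j : 'Z_q) : (i \in shifts j) = (j \in shifts i).
Proof.
suff shift_back (k l : 'Z_q) : k \in shifts l -> l \in shifts k.
  by apply/idP/idP; apply: shift_back.
by rewrite !inE => /or4P[] /eqP->; rewrite ?subrK ?addrK ?eqxx ?orbT.
Qed.

Lemma cover_adj_lift v j : j \in shifts v.2 -> exists g, cover_adj v (g, j).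
Proof.
rewrite -map_snd_cover_nbrs => /mapP[[g k] kv /= ->].
by exists g; rewrite cover_adjE.
Qed.

Lemma card_cover : #|vertex cover| = #|gT| * q.
Proof. by rewrite card_prod card_ord Zp_cast //; lia. Qed.

Hypothesis volt_onto : forall x, exists i, volt i = x.

Lemma cover_connected : connected_graph cover.
Proof.
have sheet g i : connect (@adj cover) (g, 0%R) (g, i).
  rewrite -[i]natr_Zp; elim: (nat_of_ord i) => [|k IHk]; first exact: connect0.
  apply: connect_trans IHk (connect1 _).
  by rewrite /= /cover_adj /volt_arc /= -natr1 eqxx.
have same_sheet g i j : connect (@adj cover) (g, i) (g, j).
  by apply: connect_trans (sheet g j); rewrite adj_connect_sym.
move=> [g i] [h j]; have [k volt_k] := volt_onto (g^-1 * h)%g.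
apply: connect_trans (same_sheet g i k) _; apply: connect_trans (same_sheet h (k + 2)%R j).
by apply: connect1; rewrite /= /cover_adj /volt_arc /= volt_k mulKVg eqxx orbT.
Qed.

Definition marks : seq nat := [:: 3; 4; 6].

Definition mark (v : vertex cover) : bool := (v.2 : nat) \in marks.

Definition marked_shifts (i : 'Z_q) : nat :=
  count (fun j : 'Z_q => (j : nat) \in marks) (shifts i).

Lemma card_marked_nbrs v : #|[set w | cover_adj v w & mark w]| = marked_shifts v.2.
Proof. by rewrite card_cover_nbrs /marked_shifts -map_snd_cover_nbrs count_map. Qed.

Lemma marked_shiftsE (i : 'Z_q) : marked_shifts i =
  ((i : nat) \in [:: 2; 3; 5]) + ((i : nat) \in [:: 4; 5; 7])
  + ((i : nat) \in [:: 1; 2; 4]) + ((i : nat) \in [:: 5; 6; 8]).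
Proof.
rewrite /marked_shifts /shifts; have := val_shifts i.
move: (i + 1)%R (i - 1)%R (i + 2)%R (i - 2)%R (ltn_Zq i) => a b c d i_lt [ea eb ec ed].
rewrite /= addn0 !addnA; congr (nat_of_bool _ + _ + _ + _); rewrite !inE ?ea ?eb ?ec ?ed;
  case: ifP; lia.
Qed.

Lemma marked_shifts_two (i : 'Z_q) :
  (i : nat) \notin marks -> (marked_shifts i == 2) = (i == 2 :> nat).
Proof. rewrite marked_shiftsE !inE; lia. Qed.

Lemma marked_shifts_sep (i j : 'Z_q) : i < 5 -> j < 5 ->
  ((i : nat) \in marks) = ((j : nat) \in marks) -> marked_shifts i = marked_shifts j -> i = j.
Proof.
rewrite !marked_shiftsE => i_lt j_lt eq_mark eq_shifts; apply: val_inj => /=.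
move: (nat_of_ord i) (nat_of_ord j) i_lt j_lt eq_mark eq_shifts => k l.
by case: k => [|[|[|[|[|k]]]]] //; case: l => [|[|[|[|[|l]]]]].
Qed.

Lemma shifts_two (i j : 'Z_q) : i = 2 :> nat -> (j \in shifts i) = (j < 5) && (j != i).
Proof.
move=> i2; rewrite /shifts; have := val_shifts i; rewrite i2.
have [-> ->] : 3 < q /\ 4 < q by lia.
move: (i + 1)%R (i - 1)%R (i + 2)%R (i - 2)%R => a b c d /= [ea eb ec ed].
by rewrite !inE -!val_eqE /= ea eb ec ed i2; lia.
Qed.

Section MarkedAutomorphism.

Variable s : {perm vertex cover}.
Hypothesis s_aut : s \in coloured_aut mark.

Let s_adj : forall v w, cover_adj (s v) (s w) = cover_adj v w.
Proof. by have /coloured_autP[] := s_aut. Qed.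

Let s_mark : forall v, mark (s v) = mark v.
Proof. by have /coloured_autP[] := s_aut. Qed.

Lemma marked_shifts_aut v : marked_shifts (s v).2 = marked_shifts v.2.
Proof.
rewrite -!card_marked_nbrs -[LHS](card_preimset _ (@perm_inj _ s)).
by apply: eq_card => w; rewrite !inE s_adj s_mark.
Qed.

Definition fixes_fibre (i : 'Z_q) : Prop := forall g, (s (g, i)).2 = i.

(* 2 is the only unmarked position with two marked neighbours, and its neighbours
   0, 1, 3, 4 are told apart by their mark and number of marked neighbours. *)
Lemma fixes_fibre_two (i : 'Z_q) : i = 2 :> nat -> fixes_fibre i.
Proof.
move=> i2 g; apply: val_inj; apply/eqP; rewrite /= i2 -marked_shifts_two.
  by rewrite marked_shifts_aut marked_shifts_two i2.
by rewrite [_ \in _]s_mark /mark i2.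
Qed.

Lemma fixes_fibre_small (i : 'Z_q) : i < 5 -> fixes_fibre i.
Proof.
have [two two2] : exists two : 'Z_q, two = 2 :> nat.
  by exists 2%:R%R; rewrite val_Zp_nat ?modn_small; lia.
move=> i_lt.
have [/fixes_fibre_two //|i_neq] := eqVneq (i : nat) 2; move=> g.
have [h gh] : exists h, cover_adj (g, i) (h, two).
  by apply: cover_adj_lift; rewrite shifts_sym shifts_two // i_lt -val_eqE /= two2.
have := gh; rewrite cover_adj_sym -s_adj => /cover_adj_shift.
rewrite (fixes_fibre_two two2) shifts_two // => /andP[s_lt _].
by apply: marked_shifts_sep; rewrite ?marked_shifts_aut //; apply: s_mark.
Qed.

Lemma fixes_fibre_last (i j : 'Z_q) : j \in shifts i -> fixes_fibre i ->
  (forall k, k \in shifts i -> k != j -> fixes_fibre k) -> fixes_fibre j.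
Proof.
move=> ji fix_i fix_others h; apply/eqP/negPn/negP => k_neq.
have [g hg] : exists g, cover_adj (h, j) (g, i) by apply: cover_adj_lift; rewrite shifts_sym.
rewrite cover_adj_sym in hg; have s_hg := hg; rewrite -s_adj in s_hg.
set k := (s (h, j)).2 in k_neq; have ki : k \in shifts i.
  by have := cover_adj_shift s_hg; rewrite fix_i.
have [x gx] : exists x, cover_adj (g, i) (x, k) by apply: cover_adj_lift.
have s_gx := gx; rewrite -s_adj in s_gx.
have := cover_adj_inj s_hg s_gx; rewrite (fix_others k) // => /(_ erefl)/perm_inj[_ jk].
by rewrite -jk eqxx in k_neq.
Qed.

Lemma fixes_all_fibres i : fixes_fibre i.
Proof.
suff fix4 k : [/\ fixes_fibre k%:R, fixes_fibre k.+1%:R, fixes_fibre k.+2%:R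
    & fixes_fibre k.+3%:R]%R by have [+ _ _ _] := fix4 (val i); rewrite natr_Zp.
elim: k => [|k [fix0 fix1 fix2 fix3]].
  by split; apply: fixes_fibre_small; rewrite val_Zp_nat ?modn_small; lia.
split=> //; apply: (fixes_fibre_last (i := (k.+2)%:R%R)) => // [|j].
  by rewrite !inE -!natrD addn2 eqxx !orbT.
rewrite !inE => /or4P[] /eqP->.
- by rewrite natr1.
- by rewrite -[k.+2]addn1 natrD addrK.
- by rewrite -natrD addn2 eqxx.
- by rewrite -[k.+2]addn2 natrD addrK.
Qed.

Let s_snd v : (s v).2 = v.2.
Proof. by case: v => g i; apply: fixes_all_fibres. Qed.

Lemma aut_step_one g i : (s (g, i + 1)%R).1 = (s (g, i)).1.
Proof.
have arc_gi : cover_adj (g, i) (g, i + 1)%R by rewrite /cover_adj /volt_arc /= eqxx.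
have arc_s : cover_adj (s (g, i)) ((s (g, i)).1, i + 1)%R.
  by rewrite /cover_adj /volt_arc s_snd /= eqxx.
by rewrite -s_adj in arc_gi; rewrite (cover_adj_inj arc_gi arc_s) ?s_snd.
Qed.

Lemma aut_step_two g i : (s ((g * volt i)%g, (i + 2)%R)).1 = ((s (g, i)).1 * volt i)%g.
Proof.
have arc_gi : cover_adj (g, i) ((g * volt i)%g, (i + 2)%R).
  by rewrite /cover_adj /volt_arc /= eqxx orbT.
have arc_s : cover_adj (s (g, i)) (((s (g, i)).1 * volt i)%g, (i + 2)%R).
  by rewrite /cover_adj /volt_arc s_snd /= eqxx orbT.
by rewrite -s_adj in arc_gi; rewrite (cover_adj_inj arc_gi arc_s) ?s_snd.
Qed.

Lemma aut_fst g i j : (s (g, i)).1 = (s (g, j)).1.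
Proof.
suff fst0 k : (s (g, k)).1 = (s (g, 0%R)).1 by rewrite (fst0 i) (fst0 j).
rewrite -[k]natr_Zp; elim: (nat_of_ord k) => [//|m IHm].
by rewrite -natr1 aut_step_one.
Qed.

Lemma aut_translation v : s v = (((s (1%g, 0%R)).1 * v.1)%g, v.2).
Proof.
case: v => g i; rewrite [LHS]surjective_pairing s_snd; congr (_, _).
have [k <-] := volt_onto g; rewrite (aut_fst _ i (k + 2)%R) -{1}[volt k]mul1g aut_step_two.
by rewrite (aut_fst _ k 0%R).
Qed.

End MarkedAutomorphism.

(* Permutations compose from left to right, whence the inverse. *)
Definition translate (k : gT) (v : vertex cover) : vertex cover := ((k^-1 * v.1)%g, v.2).

Lemma translate_inj k : injective (translate k).
Proof. by move=> [g i] [h j] [/mulgI-> ->]. Qed.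

Definition translation (k : gT) : {perm vertex cover} := perm (@translate_inj k).

Lemma translationM : {in [set: gT] &, {morph translation : k l / (k * l)%g}}.
Proof.
by move=> k l _ _; apply/permP => v; rewrite permM !permE /translate /= invMg mulgA.
Qed.

Canonical translation_morphism := Morphism translationM.

Lemma injm_translation : ('injm translation)%g.
Proof.
apply/injmP => k l _ _ /permP/(_ (1%g, 0%R)).
by rewrite !permE /translate /= !mulg1 => -[/invg_inj].
Qed.

Lemma translation_aut k : translation k \in coloured_aut mark.
Proof.
apply/coloured_autP; split=> [[g i] [h j] | v]; rewrite !permE //.
by rewrite /= /cover_adj /volt_arc /= !xpair_eqE -!mulgA !(inj_eq (mulgI _)).
Qed.

Lemma cover_coloured_aut_isog : coloured_aut mark \isog [set: gT].
Proof.
rewrite isog_sym /=; suff <- : (translation @* [set: gT])%g = coloured_aut mark.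
  by rewrite sub_isog ?injm_translation.
apply/setP => s; apply/morphimP/idP => [[k _ _ ->] | s_aut]; first exact: translation_aut.
exists ((s (1%g, 0%R)).1^-1)%g; rewrite ?inE //; apply/permP => v.
by rewrite permE /translate invgK -aut_translation.
Qed.

End Cover.

Definition enum_volt (gT : finGroupType) q (i : 'Z_q) : gT := nth 1%g (enum gT) i.

Lemma enum_volt_onto (gT : finGroupType) q (x : gT) :
  1 < q -> #|gT| <= q -> exists i : 'Z_q, enum_volt gT i = x.
Proof.
move=> q_gt1 gT_le; have index_lt : index x (enum gT) < (Zp_trunc q).+2.
  by rewrite Zp_cast //; apply: leq_trans gT_le; rewrite cardE index_mem mem_enum.
by exists (Ordinal index_lt); rewrite /enum_volt nth_index ?mem_enum.
Qed.

Section GroupNutGraph.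

Variables (gT : finGroupType) (t n : nat).
Hypothesis t_gt1 : 1 < t.

Local Notation q := (12 + #|gT| + n).

Let q_ge12 : 12 <= q.
Proof. by rewrite -addnA leq_addr. Qed.

Let volt_onto (x : gT) : exists i : 'Z_q, enum_volt gT i = x.
Proof. by apply: enum_volt_onto => //; rewrite addnAC leq_addl. Qed.

Definition group_cover : sgraph := cover (@enum_volt gT q) q_ge12.

Definition group_mark : vertex group_cover -> bool := @mark gT q (@enum_volt gT q) q_ge12.

Lemma group_cover_regular : regular_graph 4 group_cover.
Proof. exact: cover_regular. Qed.

Lemma group_cover_connected : connected_graph group_cover.
Proof. exact: cover_connected. Qed.

Let ports_lt : #|@ladder_port t| + #|'I_(4 * t).+3| < (4 * t).*2.
Proof.
by rewrite -(ltn_add2r 4) addnAC (card_port (ladder_gadgets_regular t_gt1)) card_ord; lia.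
Qed.

Let roots_lt : 4 + #|'I_(4 * t).+3| < (4 * t).*2.
Proof. by rewrite card_ord; lia. Qed.

Definition group_nut_graph : sgraph :=
  attach group_mark (@ladder_port t) (ladder_gadget_sym t_gt1) (@ladder_gadget_irr t).

Lemma card_group_nut_graph : #|vertex group_nut_graph| = #|gT| * q * (4 * t).+4.
Proof. by rewrite card_attach card_cover card_ord. Qed.

Lemma group_nut_graph_connected : connected_graph group_nut_graph.
Proof. exact: attach_connected (ladder_gadgets_regular t_gt1) group_cover_connected. Qed.

Lemma group_nut_graph_regular : regular_graph (4 * t) group_nut_graph.
Proof. exact: attach_regular group_cover_regular (ladder_gadgets_regular t_gt1). Qed.

Lemma group_nut_graph_nut (R : realFieldType) : nut_graph R group_nut_graph.
Proof.
apply: (attach_nut _ _ _ group_cover_regular group_cover_connected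
  (ladder_gadgets_balanced t_gt1 R)).
  by apply/card_gt0P; exists (1%g, 0%R).
by rewrite card_ord.
Qed.

Lemma group_nut_graph_aut : graph_aut group_nut_graph \isog [set: gT].
Proof.
apply: isog_trans (cover_coloured_aut_isog q_ge12 volt_onto).
exact: (attach_aut_isog _ _ _ group_cover_regular (ladder_gadgets_regular t_gt1)
  group_cover_connected (ladder_gadgets_balanced t_gt1 rat) ports_lt roots_lt
  (@ladder_gadgets_rigid _ t_gt1 rat)).
Qed.

End GroupNutGraph.

Theorem theorem2 (R : realType) (gT : finGroupType) (K : {group gT}) (d : nat)
    (hd : d \in [:: 8; 12; 16; 20; 24]) :
  exists G : nat -> sgraph,
    (forall n, [/\ connected_graph (G n), regular_graph d (G n), nut_graph R (G n)
                 & graph_aut (G n) \isog K]) /\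
    (forall m n, m <> n -> ~ graph_iso (G m) (G n)).
Proof.
have [t t_gt1 ->] : exists2 t, 1 < t & d = 4 * t.
  by move: hd; rewrite !inE => /or4P[|||/orP[]] /eqP->;
     [exists 2 | exists 3 | exists 4 | exists 5 | exists 6].
exists (fun n => group_nut_graph (subg_of K) n t_gt1); split=> [n | m n mn [f [f_bij _]]].
  split.
  - exact: group_nut_graph_connected.
  - exact: group_nut_graph_regular.
  - exact: group_nut_graph_nut.
  - apply: isog_trans (group_nut_graph_aut _ _ _) _.
    by rewrite isog_sym; apply: isog_subg.
have := bij_eq_card f_bij; rewrite !card_group_nut_graph => /eqP.
rewrite eqn_pmul2r // eqn_pmul2l; last by apply/card_gt0P; exists 1%g.
by rewrite eqn_add2l => /eqP.
Qed.
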